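(* Let $T$ be the binary tree, let $(\alpha_k)_{k\ge0}$ and $(\sigma_k)_{k\ge0}$ be sequences of positive numbers with $(\sigma_k)_{k\ge0}$ non-increasing, and let $X_t=\sigma_{|t|}\sum_{v\preceq t}\alpha_{|v|}\xi_v$, $t\in T$. Put $$G_1:=\sup_{n}\sup_{m\le n}\ \sigma_n\sqrt m\Big(\sum_{k=m}^n\alpha_k^2\Big)^{1/2},\qquad G_2:=\sup_n\ \sigma_n\sqrt n\Big(\sum_{k=0}^n\alpha_k^2\Big)^{1/2},$$ where $m,n$ range over the non-negative integers. a) If $X=(X_t)_{t\in T}$ is a.s. bounded, then $G_1<\infty$. b) If $G_2<\infty$, then $X$ is a.s. bounded. c) Moreover, if $(\alpha_k)_{k\ge0}$ is non-decreasing, then the conditions $G_1<\infty$ and $G_2<\infty$ are equivalent; thus $X$ is a.s. bounded if and only if either of them holds.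
   Context: The binary tree is the infinite rooted tree with root $\mathbf 0$ in which every element has exactly two offspring. $t\preceq s$ means that $t$ lies on the branch connecting $\mathbf 0$ with $s$ (including $t=s$); $t\prec s$ means $t\preceq s$, $t\neq s$; $|s|:=\#\{t\in T:t\prec s\}$. $(\xi_v)_{v\in T}$ are i.i.d. standard normal random variables. $X$ is a.s. bounded means $\mathbb P(\sup_{t\in T}|X_t|<\infty)=1$. *)

(* Defs.v *)
From HB Require Import structures.
From mathcomp Require Import all_boot all_order all_algebra finmap.
From mathcomp Require Import all_classical all_reals all_analysis.

Set Implicit Arguments.
Unset Strict Implicit.
Unset Printing Implicit Defensive.

Import Order.TTheory GRing.Theory Num.Theory.
Import numFieldNormedType.Exports.

Local Open Scope classical_set_scope.
Local Open Scope ring_scope.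

(* A vertex is the word of left/right choices leading to it from the root
   [::]; its two offspring are rcons t false and rcons t true. *)
Notation binary_tree := (seq bool).

Definition tree_le (t s : binary_tree) : bool := prefix t s.
Definition tree_lt (t s : binary_tree) : bool := tree_le t s && (t != s).

Definition level (t : binary_tree) : nat :=
  #|` fset_set [set s : binary_tree | tree_lt s t] |%fset.

Lemma branchE (t : binary_tree) :
  [set s : binary_tree | tree_le s t] =
    [set` [seq take k t | k <- iota 0 (size t).+1]].
Proof.
move Er : (iota 0 _) => r; apply/seteqP; split => s /=; rewrite /tree_le.
- move=> st; apply/mapP; exists (size s).
    by rewrite -Er mem_iota add0n ltnS size_prefix.
  by move: st; rewrite prefixE => /eqP.
- by case/mapP => k _ ->; rewrite -{2}(cat_take_drop k t) prefix_prefix.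
Qed.

Lemma uniq_branch (t : binary_tree) n : (n <= (size t).+1)%N ->
  uniq [seq take k t | k <- iota 0 n].
Proof.
move=> nt; rewrite map_inj_in_uniq ?iota_uniq// => i j.
rewrite !mem_iota !add0n /= => ni nj /(congr1 size).
by rewrite !size_takel// -ltnS; apply: leq_trans nt.
Qed.

Lemma levelE (t : binary_tree) : level t = size t.
Proof.
have -> : level t = #|` [fset x in [seq take k t | k <- iota 0 (size t)]]|%fset.
  rewrite /level; congr (size _); congr enum_fset.
  apply/fsetP => s.
  have E : [set s : binary_tree | tree_lt s t] =
           [set` [seq take k t | k <- iota 0 (size t)]].
    apply/seteqP; split => u /=; rewrite /tree_lt /tree_le.
    - case/andP => ut nut; apply/mapP; exists (size u); last first.
        by move: ut; rewrite prefixE => /eqP.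
      rewrite mem_iota add0n /= ltn_neqAle size_prefix// andbT.
      apply: contraNneq nut => su.
      by move: ut; rewrite prefixE su take_size => /eqP ->.
    - case/mapP => k; rewrite mem_iota add0n /= => kt ->.
      rewrite -{2}(cat_take_drop k t) prefix_prefix/=.
      apply: contraTneq kt => /(congr1 size); rewrite size_take -leqNgt.
      by case: ltnP => // kt e; rewrite e ltnn in kt.
  rewrite E in_fset_set; last exact: finite_seq.
  by rewrite inE; apply/idP/idP; rewrite inE.
by rewrite card_fseq undup_id ?uniq_branch// size_map size_iota.
Qed.

Lemma branch_sumE (V : nmodType) (t : binary_tree) (F : binary_tree -> V) :
  \sum_(v \in [set v | tree_le v t]) F v = \sum_(k < (size t).+1) F (take k t).
Proof.
rewrite branchE -fsbig_seq ?uniq_branch// big_map.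
by rewrite -[iota 0 _]/(index_iota 0 (size t).+1) big_mkord.
Qed.

Section Process.
Context d (Omega : measurableType d) (R : realType) (P : probability Omega R).

(* Equality of laws is only required on measurable sets: the measures of the
   library are functions on all sets. *)
Definition standard_normal (Z : {RV P >-> R}) : Prop :=
  forall B : set R, measurable B -> distribution P Z B = normal_prob 0 1 B.

Definition mutually_independent (I : choiceType) (Z : I -> {RV P >-> R}) : Prop :=
  forall (J : {fset I}) (B : I -> set R), (forall i, measurable (B i)) ->
    P (\bigcap_(i in [set` J]) (Z i @^-1` B i)) =
    (\prod_(i <- J) P (Z i @^-1` B i))%E.

Definition tree_process (alpha sigma : nat -> R)
    (xi : binary_tree -> {RV P >-> R}) (t : binary_tree) (w : Omega) : R :=
  sigma (level t) * \sum_(v \in [set v | tree_le v t]) (alpha (level v) * xi v w).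

Definition as_bounded (X : binary_tree -> Omega -> R) : Prop :=
  P [set w | (ereal_sup [set `|X t w|%:E | t in [set: binary_tree]] < +oo)%E] = 1%E.

End Process.

Section Conditions.
Context (R : realType).
Implicit Types alpha sigma : nat -> R.

Definition G1 alpha sigma : \bar R :=
  ereal_sup [set ereal_sup
    [set (sigma n * Num.sqrt m%:R *
          Num.sqrt (\sum_(m <= k < n.+1) alpha k ^+ 2))%:E
     | m in [set m | (m <= n)%N]]
  | n in [set: nat]].

Definition G2 alpha sigma : \bar R :=
  ereal_sup [set (sigma n * Num.sqrt n%:R *
                  Num.sqrt (\sum_(0 <= k < n.+1) alpha k ^+ 2))%:E
  | n in [set: nat]].

End Conditions.

(* Main.v *)
(* The sum of the [alpha_k xi_v] over a path is centered normal, and sums over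
   disjoint paths are independent (Gaussian convolution, one summand at a time).

   b) At level [n] the standard deviation of [X_t] is at most [G2 / sqrt n], so
   [P(|X_t| > C)] is at most a constant times [exp (- c n C^2)], which for large
   [C] beats the number [2^n] of vertices in the union bound over the tree.

   a) Fix [1 <= m <= n], extend each vertex [t] of level [m] to a vertex of level
   [n], and write [X / sigma_n = A_t + B_t], where [B_t] collects the levels
   [m .. n]. The [B_t] are independent with a common law, and each [A_t] is
   symmetric and independent of them. Looking at the first [t] with [B_t > u],
   where moreover [A_t >= 0] with probability at least 1/2, gives
   [P(max_t (A_t + B_t) > u) >= (1 - (1 - p)^(2^m)) / 2] with [p = P(B_t > u)].
   If [X] is bounded by [M] with probability close to 1, then [p 2^m] is small
   for [u = M / sigma_n], and the normal lower tail bound forces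
   [sqrt m * sd B_t <= 2 u], so [G1 <= 2 M].

   c) For non-decreasing [alpha], the upper half of a sum of the [alpha_k^2]
   carries at least half of it. *)

Require Import Defs.
From HB Require Import structures.
From mathcomp Require Import all_boot all_order all_algebra finmap.
From mathcomp Require Import all_classical all_reals all_analysis.
From mathcomp Require Import measurable_realfun ring lra.

Import Order.TTheory GRing.Theory Num.Theory.
Import numFieldNormedType.Exports.

Local Open Scope classical_set_scope.
Local Open Scope ring_scope.

Set Implicit Arguments.
Unset Strict Implicit.
Unset Printing Implicit Defensive.

(** * Centered normal laws *)

Section affine_substitution.
Context {R : realType}.
Local Notation mu := (@lebesgue_measure R).
Implicit Types (a b : R) (A : set R) (f : R -> \bar R).

Lemma affine_preimage_itv a b (x y : R) : 0 < a ->
  (fun z => a * z + b) @^-1` `]x, y] = `](x - b) / a, (y - b) / a]%classic.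
Proof.
move=> a0; apply/seteqP; split => z /=; rewrite !in_itv/=;
  by rewrite ltr_pdivrMr// ler_pdivlMr// ltrBlDr lerBrDr mulrC.
Qed.

Lemma measurable_affine a b :
  measurable_fun [set: measurableTypeR R]
    (fun z => a * z + b : measurableTypeR R).
Proof. by exact: measurable_funD. Qed.

(** Uniqueness of Lebesgue measure: [a] times its pushforward under the affine map agrees with it on
    half-open intervals. *)
Lemma lebesgue_measure_affine a b A : 0 < a -> measurable A ->
  mu ((fun z => a * z + b) @^-1` A) = (a^-1%:E * mu A)%E.
Proof.
move=> a0 mA.
pose phi (z : measurableTypeR R) : measurableTypeR R := a * z + b.
pose a' := NngNum (ltW a0).
pose nu0 : {measure set (measurableTypeR R) -> \bar R} :=
  mscale a' (pushforward mu phi).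
pose nu := nu0 (measurable_affine a b).
have -> : mu A = nu A.
  apply: (@lebesgue_measure_unique R nu) => // _ [[x y]] _ <-.
  transitivity (a%:E * mu ((fun z => a * z + b)%R @^-1` `]x, y]))%E => //.
  rewrite affine_preimage_itv//.
  rewrite !lebesgue_measure_itv /= !lte_fin ltr_pM2r ?invr_gt0//.
  rewrite ltrD2r; case: ifP => _; last by rewrite mule0.
  by rewrite -!EFinD -EFinM -mulrBl mulrCA mulfV ?gt_eqF// mulr1; congr EFin; ring.
transitivity (a^-1%:E * (a%:E * mu ((fun z => a * z + b)%R @^-1` A)))%E => //.
by rewrite muleA -EFinM mulVf ?gt_eqF// mul1e.
Qed.

Lemma ge0_integral_affine a b f : 0 < a -> measurable_fun setT f ->
  (forall x, 0 <= f x)%E ->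
  (\int[mu]_x f (a * x + b)%R = a^-1%:E * \int[mu]_x f x)%E.
Proof.
move=> a0 mf f0.
have i0 : 0 <= a^-1 by rewrite invr_ge0 ltW.
have <- := @ge0_integral_mscale _ _ _ mu _ measurableT (NngNum i0) f mf
  (fun x _ => f0 x).
have := @ge0_integral_pushforward _ _ _ _ R _ (measurable_affine a b) mu setT f
  measurableT mf (fun x _ => f0 x).
rewrite preimage_setT => <-.
apply: eq_measure_integral => [|mphi A mA _]; first exact: measurable_affine.
exact: (lebesgue_measure_affine b a0 mA).
Qed.

End affine_substitution.

(** * Normal densities: integration, scaling, products *)

Section normal_law.
Context {R : realType}.
Local Notation mu := (@lebesgue_measure R).
Implicit Types (m s t c x y : R) (A B : set R).

Lemma normal_prob_indic m s B : measurable B ->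
  normal_prob m s B = (\int[mu]_x (normal_pdf m s x * \1_B x)%:E)%E.
Proof.
move=> mB; rewrite /normal_prob integral_mkcond.
apply: eq_integral => x _; rewrite patchE indicE.
by case: ifPn => _; rewrite (mulr1, mulr0).
Qed.

(** The Radon-Nikodym derivative of the normal law is almost everywhere its density. The bounds on
    [f] give the integrability that the change of variables asks for. *)
Lemma integral_normal_prob m s (f : R -> R) :
  measurable_fun setT f -> (forall x, 0 <= f x <= 1) ->
  (\int[normal_prob m s]_x (f x)%:E =
   \int[mu]_x (normal_pdf m s x * f x)%:E)%E.
Proof.
move=> mf f01.
have mfE : measurable_fun setT (EFin \o f) by exact/measurable_EFinP.
have fi : (normal_prob m s).-integrable setT (EFin \o f).
  apply/integrableP; split => //.
  apply: (@le_lt_trans _ _ (\int[normal_prob m s]_x cst 1%E x)%E); last first.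
    by rewrite integral_cst// mul1e -ge0_fin_numE// fin_num_measure.
  apply: ge0_le_integral => //=.
    by apply/measurable_EFinP; exact: measurableT_comp.
  by move=> x _; rewrite lee_fin; have /andP[? ?] := f01 x; rewrite ger0_norm.
have dom := normal_prob_dominates m s.
rewrite -(Radon_Nikodym_change_of_variables dom)//=.
have mpdf : measurable_fun setT (EFin \o normal_pdf m s).
  by apply/measurable_EFinP; exact: measurable_normal_pdf.
under [RHS]eq_integral do rewrite EFinM muleC.
apply: ae_eq_integral => //.
- exact: emeasurable_funM.
- exact: emeasurable_funM.
- apply: ae_eqe_mul2l; rewrite Radon_NikodymE//=.
  case: cid => /= h [h1 h2 h3]; apply: integral_ae_eq => //=.
  by move=> E _ mE; rewrite -h3.
Qed.

Lemma normal_pdf_expR m s x : 0 < s ->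
  normal_pdf m s x = (s * Num.sqrt (pi *+ 2))^-1 *
                     expR (- ((x - m) ^+ 2 / (s ^+ 2 *+ 2))).
Proof.
move=> s0; rewrite /normal_pdf gt_eqF// /normal_peak /normal_fun mulNr.
by rewrite -mulrnAr sqrtrM ?sqr_ge0// sqrtr_sqr gtr0_norm.
Qed.

Lemma normal_pdf_scale c x : 0 < c ->
  c * normal_pdf 0 c (c * x) = normal_pdf 0 1 x.
Proof.
move=> c0; have c0' : c != 0 by rewrite gt_eqF.
rewrite !normal_pdf_expR// !subr0 mul1r invfM !mulrA mulfV// mul1r.
congr (_ * expR (- _)); rewrite expr1n exprMn -[in LHS]mulr_natr -[LHS]mulf_div.
by rewrite divff ?expf_neq0// mul1r.
Qed.

Lemma measurable_normal_pdf_indic m s B : measurable B ->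
  measurable_fun setT (fun x => (normal_pdf m s x * \1_B x)%:E).
Proof.
move=> mB; apply/measurable_EFinP; apply: measurable_funM.
  exact: measurable_normal_pdf.
exact: measurable_indic.
Qed.

Lemma normal_pdf_indic_ge0 m s B x : (0 <= (normal_pdf m s x * \1_B x)%:E)%E.
Proof. by rewrite lee_fin mulr_ge0// normal_pdf_ge0. Qed.

Lemma normal_prob_scale c B : 0 < c -> measurable B ->
  normal_prob 0 1 ((fun x => c * x) @^-1` B) = normal_prob 0 c B.
Proof.
move=> c0 mB.
have mcB : measurable ((fun x => c * x) @^-1` B).
  have mc : measurable_fun setT (fun x => c * x) by exact: measurable_funM.
  by rewrite -[_ @^-1` _]setTI; exact: mc.
rewrite !normal_prob_indic//.
have mf := measurable_normal_pdf_indic 0 c mB.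
have -> : (\int[mu]_x (normal_pdf 0 c x * \1_B x)%:E =
    c%:E * \int[mu]_x (normal_pdf 0 c (c * x + 0) * \1_B (c * x + 0))%:E)%E.
  rewrite (ge0_integral_affine 0 c0 mf (@normal_pdf_indic_ge0 0 c B)).
  by rewrite muleA -EFinM mulfV ?gt_eqF// mul1e.
rewrite -ge0_integralZl//; last 3 first.
- exact: (measurableT_comp mf (measurable_affine c 0)).
- by move=> x _; exact: normal_pdf_indic_ge0.
- by rewrite lee_fin ltW.
apply: eq_integral => x _; rewrite addr0 -EFinM; congr EFin.
rewrite mulrA; congr (_ * _).
by rewrite normal_pdf_scale.
Qed.

(* Completing the square in [x]. *)
Lemma normal_pdf_mul s t x y : 0 < s -> 0 < t ->
  normal_pdf 0 s x * normal_pdf x t y =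
  normal_pdf 0 (Num.sqrt (s ^+ 2 + t ^+ 2)) y *
  normal_pdf (s ^+ 2 * y / (s ^+ 2 + t ^+ 2))
             (s * t / Num.sqrt (s ^+ 2 + t ^+ 2)) x.
Proof.
move=> s0 t0; have r2 : 0 < s ^+ 2 + t ^+ 2 by rewrite addr_gt0// exprn_gt0.
have r0 : 0 < Num.sqrt (s ^+ 2 + t ^+ 2) by rewrite sqrtr_gt0.
have rE : Num.sqrt (s ^+ 2 + t ^+ 2) ^+ 2 = s ^+ 2 + t ^+ 2.
  by rewrite sqr_sqrtr// ltW.
move: (Num.sqrt (s ^+ 2 + t ^+ 2)) r0 rE => r r0 rE.
rewrite !normal_pdf_expR ?divr_gt0 ?mulr_gt0//.
rewrite mulrACA -expRD [RHS]mulrACA -expRD; congr (_ * expR _).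
  by rewrite -!invfM; congr (_^-1); field; rewrite gt_eqF.
rewrite expr_div_n rE !mulr2n; field.
by rewrite !gt_eqF ?addr_gt0 ?mulr_gt0 ?exprn_gt0.
Qed.

End normal_law.

(** * Convolution of centered normal laws *)

Section normal_convolution.
Context {R : realType}.
Local Notation mu := (@lebesgue_measure R).
Implicit Types (s t c x y : R) (B : set R).

Lemma normal_prob_shift m t x B : 0 < t -> measurable B ->
  normal_prob m t ((fun y => y + x) @^-1` B) = normal_prob (m + x) t B.
Proof.
move=> t0 mB.
have maff : measurable_fun setT (fun y : R => 1 * y + x) := measurable_affine 1 x.
have mx : measurable ((fun y => y + x) @^-1` B).
  rewrite -[_ @^-1` _]setTI; have := maff measurableT B mB.
  by under [X in X @^-1` _]eq_fun do rewrite mul1r.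
rewrite !normal_prob_indic//.
have mf := measurable_normal_pdf_indic (m + x) t mB.
rewrite -[RHS]mul1e -[X in (X%:E * _)%E]invr1.
rewrite -(ge0_integral_affine x ltr01 mf)//; last first.
  by move=> y; exact: normal_pdf_indic_ge0.
apply: eq_integral => y _; rewrite mul1r; congr (_ * _)%:E.
by rewrite !normal_pdf_expR// opprD addrACA subrr addr0.
Qed.

Lemma measurable_normal_pdf2 t : 0 < t ->
  measurable_fun setT (fun z : R * R => normal_pdf z.1 t z.2).
Proof.
move=> t0.
under eq_fun do rewrite normal_pdf_expR//.
apply: measurable_funM => //; apply: measurableT_comp => //.
apply: measurable_funN; apply: measurable_funM => //.
apply: measurable_funX; exact: measurable_funB.
Qed.

(** The left side is a double integral of a product of densities. After Tonelli and
    [normal_pdf_mul], the inner integral over [x] is the total mass of a normal density, leaving the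
    density of the sum. *)
Lemma normal_prob_convolution s t B : 0 < s -> 0 < t -> measurable B ->
  (normal_prob 0 s \x normal_prob 0 t)%E [set z | B (z.1 + z.2)] =
  normal_prob 0 (Num.sqrt (s ^+ 2 + t ^+ 2)) B.
Proof.
move=> s0 t0 mB; rewrite /product_measure1.
set A := [set z : R * R | B (z.1 + z.2)].
have mA : measurable A.
  have madd : measurable_fun setT (fun z : R * R => z.1 + z.2).
    exact: measurable_funD.
  by rewrite -[A]setTI; exact: madd.
have sect x : normal_prob 0 t (xsection A x) = normal_prob x t B.
  rewrite -[in RHS](add0r x) -normal_prob_shift//; congr (normal_prob _ _ _).
  by apply/seteqP; split => y; rewrite /xsection/= inE /A/= addrC.
have fin x : normal_prob x t B \is a fin_num by rewrite fin_num_measure.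
pose g x := fine (normal_prob x t B).
have mg : measurable_fun setT g.
  have := measurable_fun_xsection (normal_prob 0 t) mA.
  have -> : (normal_prob 0 t : set R -> \bar R) \o xsection A =
            fun x => normal_prob x t B by apply/funext => x /=.
  by move=> h; apply: measurableT_comp.
under eq_integral do rewrite /= sect -(fineK (fin _)).
rewrite (@integral_normal_prob _ 0 s g)//; last first.
  move=> x; rewrite /g fine_ge0//= -lee_fin fineK//.
  exact: probability_le1.
pose h z := (normal_pdf 0 s z.1 * normal_pdf z.1 t z.2 * \1_B z.2)%:E.
have mh : measurable_fun setT (h : R * R -> \bar R).
  apply/measurable_EFinP; apply: measurable_funM; last first.
    by apply: measurableT_comp => //; exact: measurable_indic.
  apply: measurable_funM; last exact: measurable_normal_pdf2.
  by apply: measurableT_comp => //; exact: measurable_normal_pdf.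
have h0 z : (0 <= h z)%E by rewrite lee_fin !mulr_ge0// normal_pdf_ge0.
transitivity (\int[mu]_x \int[mu]_y h (x, y))%E.
  apply: eq_integral => x _; rewrite EFinM /g fineK// normal_prob_indic//.
  rewrite -ge0_integralZl//; last 3 first.
  - exact: measurable_normal_pdf_indic.
  - by move=> y _; exact: normal_pdf_indic_ge0.
  - by rewrite lee_fin normal_pdf_ge0.
  by apply: eq_integral => y _; rewrite -EFinM mulrA.
rewrite fubini_tonelli// normal_prob_indic//.
apply: eq_integral => y _; rewrite /h/=.
set r := Num.sqrt _.
under eq_integral => x _ do
  rewrite normal_pdf_mul// mulrAC EFinM.
rewrite ge0_integralZl//; last 3 first.
- by apply/measurable_EFinP; exact: measurable_normal_pdf.
- by move=> x _; rewrite lee_fin normal_pdf_ge0.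
- exact: normal_pdf_indic_ge0.
by rewrite integral_normal_pdf mule1.
Qed.

End normal_convolution.

(** * Tail bounds *)

Section normal_tails.
Context {R : realType}.
Local Notation mu := (@lebesgue_measure R).
Implicit Types (s t u x y : R) (B : set R).

(** Half of the exponent [x^2 / (2 s^2)] is bounded below through [|x| > u]; the other half is the
    exponent of the normal density with deviation [sqrt 2 * s], whose integral is 1. *)
Lemma normal_prob_norm_gt_le s u : 0 < s -> 0 <= u ->
  (normal_prob 0 s [set x | (u < `|x|)%R] <=
   (Num.sqrt 2 * expR (- (u ^+ 2 / (s ^+ 2 * 4))))%:E)%E.
Proof.
move=> s0 u0; set B := [set x | _].
have mB : measurable B.
  have mn : measurable_fun setT (fun x : R => `|x|) by exact: measurableT_comp.
  have -> : B = (fun x : R => `|x|) @^-1` `]u, +oo[.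
    by apply/seteqP; split => x /=; rewrite in_itv/= andbT.
  by rewrite -[_ @^-1` _]setTI; exact: mn.
set t := Num.sqrt 2 * s; set k := Num.sqrt 2 * _.
have r20 : 0 < Num.sqrt (2 : R) by rewrite sqrtr_gt0.
have t0 : 0 < t by rewrite mulr_gt0.
have k0 : 0 <= k by rewrite mulr_ge0 ?expR_ge0// ltW.
have -> : k%:E = (k%:E * \int[mu]_x (normal_pdf 0 t x)%:E)%E.
  by rewrite integral_normal_pdf mule1.
rewrite -ge0_integralZl//; last 2 first.
- by apply/measurable_EFinP; exact: measurable_normal_pdf.
- by move=> x _; rewrite lee_fin normal_pdf_ge0.
rewrite normal_prob_indic//; apply: ge0_le_integral => //.
- by move=> x _; exact: normal_pdf_indic_ge0.
- exact: measurable_normal_pdf_indic.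
- apply: measurable_funeM.
  by apply/measurable_EFinP; exact: measurable_normal_pdf.
move=> x _; rewrite -EFinM lee_fin indicE.
have [|_] := boolP (x \in B); last by rewrite mulr0 mulr_ge0// normal_pdf_ge0.
rewrite inE /B/= mulr1 => ux.
have x2 : u ^+ 2 <= x ^+ 2.
  by rewrite -(real_normK (num_real x)) lerXn2r ?nnegrE ?normr_ge0// ltW.
rewrite !normal_pdf_expR// !subr0 /k /t.
have peakE : Num.sqrt 2 * (Num.sqrt 2 * s * Num.sqrt (pi *+ 2))^-1 =
    (s * Num.sqrt (pi *+ 2 : R))^-1.
  by rewrite -mulrA [in LHS]invfM mulVKf// gt_eqF.
rewrite mulrACA -expRD peakE ler_wpM2l// ?invr_ge0 ?mulr_ge0 ?(ltW s0)//.
rewrite ler_expR exprMn sqr_sqrtr//.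
have w0 : 0 < s ^+ 2 by rewrite exprn_gt0.
move: (u ^+ 2) (x ^+ 2) (s ^+ 2) x2 w0 => v y w vy w0.
have -> : - (v / (w * 4)) + - (y / (2 * w *+ 2)) =
    - ((v + y) / (w * 4)).
  by rewrite -[_ *+ 2]mulr_natr; field; rewrite gt_eqF.
have -> : y / (w *+ 2) = (y + y) / (w * 4).
  by rewrite -[_ *+ 2]mulr_natr; field; rewrite gt_eqF.
by rewrite lerN2 ler_pM2r ?invr_gt0 ?mulr_gt0// lerD2r.
Qed.

(** Only the interval from [u] to [u + s] is kept; there the density is at least its value at
    [u + s]. *)
Lemma normal_prob_gt_ge s u : 0 < s -> 0 <= u ->
  (((Num.sqrt (pi *+ 2))^-1 * expR (- ((u / s + 1) ^+ 2 / 2)))%:E <=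
   normal_prob 0 s `]u, +oo[)%E.
Proof.
move=> s0 u0; set k := _^-1 * _.
have k0 : 0 <= k by rewrite mulr_ge0 ?invr_ge0 ?expR_ge0.
have -> : k%:E = (\int[mu]_(x in `]u, (u + s)%R[) (k / s)%:E)%E.
  have ls : mu `]u, (u + s)[%classic = s%:E.
    rewrite lebesgue_measure_itv/= lte_fin ltrDl s0.
    by rewrite -EFinD [u + s]addrC addrK.
  by rewrite integral_cst//= ls -EFinM divfK ?gt_eqF.
apply: (@le_trans _ _ (normal_prob 0%R s `]u, (u + s)%R[)); last first.
  by rewrite le_measure ?inE//; apply: subset_itvl.
apply: ge0_le_integral => //.
- by move=> x _; rewrite lee_fin divr_ge0// ltW.
- by apply/measurable_EFinP/measurable_funTS; exact: measurable_normal_pdf.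
move=> x; rewrite /= in_itv/= => /andP[ux xu].
rewrite lee_fin normal_pdf_expR// subr0 /k mulrAC -invfM [_ * s]mulrC.
rewrite ler_wpM2l ?invr_ge0 ?mulr_ge0 ?(ltW s0)// ler_expR lerN2.
have -> : (u / s + 1) ^+ 2 / 2 = (u + s) ^+ 2 / (s ^+ 2 *+ 2).
  rewrite -[X in u / s + X](divff (lt0r_neq0 s0)) -mulrDl expr_div_n.
  by rewrite -mulrA -invfM mulr_natr.
rewrite ler_wpM2r// ?invr_ge0 ?mulrn_wge0 ?sqr_ge0//.
by rewrite lerXn2r ?nnegrE ?(ltW xu) ?addr_ge0 ?(ltW s0)//; lra.
Qed.

Lemma normal_prob_ge0_ge_half s : 0 < s ->
  ((2^-1)%:E <= normal_prob 0 s `[0%R, +oo[)%E.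
Proof.
move=> s0.
have E : normal_prob 0 s `[0, +oo[ = normal_prob 0 s `]-oo, 0].
  rewrite /normal_prob [LHS]ge0_integration_by_substitution0//.
  - apply: eq_integral => x _.
    by rewrite !normal_pdf_expR// !subr0 sqrrN.
  - by apply/measurable_EFinP; exact: measurable_normal_pdf.
  - by move=> x; rewrite lee_fin normal_pdf_ge0.
have : (1 <= normal_prob 0%R s `[0%R, +oo[ + normal_prob 0%R s `]-oo, 0%R])%E.
  rewrite -(probability_setT (normal_prob 0 s)).
  have -> : [set: R] = `[0, +oo[ `|` `]-oo, 0].
    apply/esym; rewrite -subTset => x _; rewrite /setU/= !in_itv/= andbT.
    by apply/orP; exact: le_total.
  exact: measureU2.
rewrite -E -(@fineK _ (normal_prob 0 s `[0, +oo[)) ?fin_num_measure//.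
by rewrite -EFinD !lee_fin; lra.
Qed.

End normal_tails.

(** * Sums of independent normal variables *)

Lemma measurable_preimageT d d' (T : measurableType d) (U : measurableType d')
    (f : T -> U) (B : set U) :
  measurable_fun setT f -> measurable B -> measurable (f @^-1` B).
Proof. by move=> mf mB; rewrite -[_ @^-1` _]setTI; exact: mf. Qed.

Section independent_normal_sums.
Context d (Omega : measurableType d) (R : realType) (P : probability Omega R).
Implicit Types (s t : R) (E : set Omega) (B C : set R).

(** Conditionally on [E], the pair has a product law, because it does so on rectangles; the
    convolution formula then applies. *)
Lemma normal_sum_pair E (Y1 Y2 : Omega -> R) s t :
  0 < s -> 0 < t -> measurable E ->
  measurable_fun setT Y1 -> measurable_fun setT Y2 ->
  (forall B C, measurable B -> measurable C ->
    P (E `&` (Y1 @^-1` B `&` Y2 @^-1` C)) =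
    P E * (normal_prob 0 s B * normal_prob 0 t C))%E ->
  forall C, measurable C ->
    P (E `&` (fun w => Y1 w + Y2 w) @^-1` C) =
    (P E * normal_prob 0%R (Num.sqrt (s ^+ 2 + t ^+ 2))%R C)%E.
Proof.
move=> s0 t0 mE mY1 mY2 indE C mC.
(* The conditional law divides by [P E], so null events are treated apart. *)
have [PE0|PE0] := eqVneq (P E) 0%E.
  rewrite PE0 mul0e; apply/eqP; rewrite -measure_le0 -PE0 le_measure ?inE//.
  by apply: measurableI => //; exact: measurable_preimageT (measurable_funD mY1 mY2) mC.
have PEfin : P E \is a fin_num by rewrite fin_num_measure.
have p0 : 0 < fine (P E) by rewrite fine_gt0// lt0e PE0 measure_ge0 ltey_eq PEfin.
have ip0 : 0 <= (fine (P E))^-1 by rewrite invr_ge0 ltW.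
pose Y (w : Omega) : measurableTypeR R * measurableTypeR R := (Y1 w, Y2 w).
have mY : measurable_fun setT Y by exact: measurable_fun_pair.
pose m0 : {measure set (measurableTypeR R * measurableTypeR R) -> \bar R} :=
  mscale (NngNum ip0) (pushforward (mrestr P mE) Y).
pose m := m0 mY.
have madd : measurable_fun setT
    (fun z : measurableTypeR R * measurableTypeR R => (z.1 + z.2 : R)).
  exact: measurable_funD.
have mA : measurable
    [set z : measurableTypeR R * measurableTypeR R | C (z.1 + z.2)].
  exact: (measurable_preimageT madd mC).
have PEE : P E = (fine (P E))%:E by rewrite fineK.
have prodE (A B : set (measurableTypeR R)) : measurable A -> measurable B ->
    m (A `*` B) = (normal_prob 0 s A * normal_prob 0 t B)%E.
  move=> mA' mB.
  transitivity (((fine (P E))^-1)%:E * P (E `&` (Y1 @^-1` A `&` Y2 @^-1` B)))%E.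
    by congr (_ * P _)%E; rewrite setIC.
  by rewrite indE// {2}PEE muleA -EFinM mulVf ?gt_eqF// mul1e.
have mD D : m D = (((fine (P E))^-1)%:E * P (Y @^-1` D `&` E))%E by [].
have mE' : m [set z : measurableTypeR R * measurableTypeR R | C (z.1 + z.2)] =
    normal_prob 0 (Num.sqrt (s ^+ 2 + t ^+ 2)) C.
  rewrite -normal_prob_convolution//; apply/esym.
  exact: (@product_measure_unique _ _ _ _ R (normal_prob 0 s) (normal_prob 0 t)
    m prodE).
by rewrite -mE' mD {1}PEE muleA -EFinM mulfV ?gt_eqF// mul1e setIC.
Qed.

End independent_normal_sums.

(** * Sums over disjoint blocks of an independent family *)

Section independent_normal_families.
Context d (Omega : measurableType d) (R : realType) (P : probability Omega R).
Context (I : choiceType) (Z : I -> Omega -> R) (s : I -> R).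
Hypothesis mZ : forall i, measurable_fun setT (Z i).
Hypothesis s_gt0 : forall i, 0 < s i.
Implicit Types (E : set Omega) (B : I -> set R) (r : seq I).

Definition cylinder (J : Type) (Y : J -> Omega -> R) (r : seq J)
    (B : J -> set R) : set Omega :=
  \big[setI/setT]_(i <- r) (Y i @^-1` B i).

Lemma measurable_cylinder (J : Type) (Y : J -> Omega -> R) (r : seq J)
    (B : J -> set R) :
  (forall i, measurable_fun setT (Y i)) -> (forall i, measurable (B i)) ->
  measurable (cylinder Y r B).
Proof.
move=> mY mB; apply: big_ind => // [|i _]; first exact: measurableI.
exact: measurable_preimageT.
Qed.

(* The factor [P E] on the right makes the family independent of [E] as well. *)
Definition indep_normal_given E r := forall B, (forall i, measurable (B i)) ->
  P (E `&` cylinder Z r B) = (P E * \prod_(i <- r) normal_prob 0%R (s i) (B i))%E.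

Definition sum_over r (w : Omega) : R := \sum_(i <- r) Z i w.

Definition sd_over r : R := Num.sqrt (\sum_(i <- r) s i ^+ 2).

Lemma measurable_sum_over r : measurable_fun setT (sum_over r).
Proof. exact: measurable_sum. Qed.

Lemma sum_sqr_gt0 r : r != [::] -> 0 < \sum_(i <- r) s i ^+ 2.
Proof.
case: r => // a r _; rewrite big_cons ltr_pwDl ?exprn_gt0//.
by apply: sumr_ge0 => i _; rewrite sqr_ge0.
Qed.

Lemma sd_over_gt0 r : r != [::] -> 0 < sd_over r.
Proof. by move=> r0; rewrite sqrtr_gt0 sum_sqr_gt0. Qed.

(** Events on the first block can be absorbed into the conditioning event. This drives the two
    inductions below. *)
Lemma indep_normal_given_cat E r1 r2 B : uniq (r1 ++ r2) ->
  (forall i, measurable (B i)) -> indep_normal_given E (r1 ++ r2) ->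
  P (E `&` cylinder Z r1 B) =
    (P E * \prod_(i <- r1) normal_prob 0%R (s i) (B i))%E /\
  indep_normal_given (E `&` cylinder Z r1 B) r2.
Proof.
rewrite cat_uniq => /and3P[_ /hasPn r12 _] mB ind.
have key B' : (forall i, measurable (B' i)) ->
    P (E `&` cylinder Z r1 B `&` cylinder Z r2 B') =
    (P E * (\prod_(i <- r1) normal_prob 0%R (s i) (B i) *
            \prod_(i <- r2) normal_prob 0%R (s i) (B' i)))%E.
  (* As [r1] and [r2] are disjoint, the two families of test sets glue into one. *)
  move=> mB'; pose C i := if i \in r1 then B i else B' i.
  have C1 i : i \in r1 -> B i = C i by rewrite /C => ->.
  have C2 i : i \in r2 -> B' i = C i by rewrite /C => /r12/negbTE ->.
  have -> : cylinder Z r1 B = cylinder Z r1 C.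
    by apply: eq_big_seq => i /C1 ->.
  have -> : cylinder Z r2 B' = cylinder Z r2 C.
    by apply: eq_big_seq => i /C2 ->.
  rewrite (eq_big_seq (fun i => normal_prob 0 (s i) (C i))); last first.
    by move=> i /C1 ->.
  rewrite [X in (_ * (_ * X))%E](eq_big_seq
    (fun i => normal_prob 0 (s i) (C i))); last by move=> i /C2 ->.
  rewrite -big_cat -ind; last by move=> i; rewrite /C; case: ifP.
  by rewrite /cylinder big_cat/= setIA.
have P1 : P (E `&` cylinder Z r1 B) =
    (P E * \prod_(i <- r1) normal_prob 0%R (s i) (B i))%E.
  have := key (fun=> setT) (fun=> measurableT).
  rewrite {2}/cylinder big1 ?setIT; last by move=> i _; rewrite preimage_setT.
  by rewrite [X in (_ * (_ * X))%E]big1 ?mule1// => i _; rewrite probability_setT.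
by split=> // B' mB'; rewrite key// P1 muleA.
Qed.

(** Induction with [E] general: the event on the first variable joins [E] before the induction
    hypothesis is applied to the remaining sum, and [normal_sum_pair] adds the two. The base case is
    a singleton, so that all deviations stay positive. *)
Lemma sum_over_normal_given E r : uniq r -> r != [::] -> measurable E ->
  indep_normal_given E r -> forall C, measurable C ->
  P (E `&` sum_over r @^-1` C) = (P E * normal_prob 0%R (sd_over r) C)%E.
Proof.
elim: r E => // a [|b r] IH E ur _ mE ind C mC.
  have := ind (fun=> C) (fun=> mC).
  rewrite /cylinder !big_cons !big_nil setIT mule1.
  rewrite /sd_over big_cons big_nil addr0 sqrtr_sqr gtr0_norm// => <-.
  congr (P (_ `&` _)); apply/seteqP; split => w /=;
    by rewrite /sum_over big_cons big_nil addr0.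
have br0 : b :: r != [::] by [].
have := @normal_sum_pair _ _ _ P E (Z a) (sum_over (b :: r)) _ _
  (s_gt0 a) (sd_over_gt0 br0) mE (mZ a) (measurable_sum_over (b :: r)).
have -> : Num.sqrt (s a ^+ 2 + sd_over (b :: r) ^+ 2) = sd_over (a :: b :: r).
  by rewrite /sd_over sqr_sqrtr ?(ltW (sum_sqr_gt0 br0))// [in RHS]big_cons.
have -> : (fun w => Z a w + sum_over (b :: r) w) = sum_over (a :: b :: r).
  by apply/funext => w; rewrite /sum_over [in RHS]big_cons.
apply => // B D mB mD.
have [PB indB] := @indep_normal_given_cat E [:: a] (b :: r) (fun=> B) ur
  (fun=> mB) ind.
have cylB : cylinder Z [:: a] (fun=> B) = Z a @^-1` B.
  by rewrite /cylinder big_cons big_nil setIT.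
rewrite cylB big_cons big_nil mule1 in PB; rewrite cylB in indB.
have mEB : measurable (E `&` Z a @^-1` B).
  by apply: measurableI => //; exact: measurable_preimageT.
have ubr : uniq (b :: r) by case/andP: ur.
by rewrite setIA (IH _ ubr br0 mEB indB _ mD) PB -muleA.
Qed.

(** Induction on the blocks. The event [F] on the later sums joins [E], and the first block is
    summed given [E] and [F]. That it is independent of them follows from the induction hypothesis,
    applied with the events of the first block joined to [E]. *)
Lemma sums_over_normal_given (K : Type) (g : K -> seq I) (ks : seq K) E :
  (forall k, g k != [::]) -> uniq (flatten [seq g k | k <- ks]) ->
  measurable E -> indep_normal_given E (flatten [seq g k | k <- ks]) ->
  forall C : K -> set R, (forall k, measurable (C k)) ->
  P (E `&` cylinder (fun k => sum_over (g k)) ks C) =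
  (P E * \prod_(k <- ks) normal_prob 0%R (sd_over (g k)) (C k))%E.
Proof.
move=> g0; elim: ks E => [|k ks IH] E /= uks mE ind C mC.
  by rewrite /cylinder !big_nil setIT mule1.
have uk : uniq (g k) by move: uks; rewrite cat_uniq => /andP[].
have uks' : uniq (flatten [seq g k | k <- ks]).
  by move: uks; rewrite cat_uniq => /and3P[].
have mS k' : measurable_fun setT (sum_over (g k')).
  exact: measurable_sum_over.
pose F := cylinder (fun k => sum_over (g k)) ks C.
have mF : measurable F by exact: measurable_cylinder.
have [_ indT] := indep_normal_given_cat uks (fun=> measurableT) ind.
have cylT : cylinder Z (g k) (fun=> setT) = setT.
  by rewrite /cylinder big1// => i _; rewrite preimage_setT.
rewrite cylT setIT in indT.
have -> : E `&` cylinder (fun k => sum_over (g k)) (k :: ks) C =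
          (E `&` F) `&` sum_over (g k) @^-1` C k.
  by rewrite /F /cylinder big_cons setIA setIAC.
have PEF : P (E `&` F) =
    (P E * \prod_(k <- ks) normal_prob 0%R (sd_over (g k)) (C k))%E.
  exact: IH.
rewrite sum_over_normal_given//; first last.
- move=> B mB.
  have [PB indB] := indep_normal_given_cat uks mB ind.
  have mEB : measurable (E `&` cylinder Z (g k) B).
    by apply: measurableI => //; exact: measurable_cylinder.
  by rewrite -setIA [F `&` _]setIC setIA IH// PB PEF muleAC.
- exact: measurableI.
by rewrite PEF big_cons -muleA [X in (_ * X)%E]muleC.
Qed.

End independent_normal_families.

(** * The process on the tree *)

Section tree_paths.
Implicit Types (t v : seq bool) (m n : nat).

Definition words n : seq (seq bool) := [seq tval u | u <- enum {: n.-tuple bool}].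

Lemma size_words n : size (words n) = (2 ^ n)%N.
Proof. by rewrite size_map -cardE card_tuple card_bool. Qed.

Lemma uniq_words n : uniq (words n).
Proof. by rewrite map_inj_uniq ?enum_uniq//; exact: val_inj. Qed.

Lemma mem_words n t : (t \in words n) = (size t == n).
Proof.
apply/mapP/eqP => [[u _ ->]|tn]; first by rewrite size_tuple.
by exists (tcast tn (in_tuple t)); rewrite ?mem_enum// val_tcast.
Qed.

(* Vertices at levels [m], ..., [n - 1] of the branch through [t]. *)
Definition segment m n t := [seq take k t | k <- index_iota m n].

Lemma mem_segment m n t v : (n <= (size t).+1)%N -> v \in segment m n t ->
  (m <= size v < n)%N /\ v = take (size v) t.
Proof.
move=> nt /mapP[k]; rewrite mem_index_iota => /andP[mk kn] ->.
have kt : (k <= size t)%N by rewrite -ltnS (leq_trans kn).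
by rewrite !size_takel// mk kn.
Qed.

Lemma uniq_segment m n t : (n <= (size t).+1)%N -> uniq (segment m n t).
Proof.
move=> nt; rewrite map_inj_in_uniq ?iota_uniq// => i j.
rewrite !mem_index_iota => /andP[_ ni] /andP[_ nj] /(congr1 size).
by rewrite !size_takel// -ltnS; apply: leq_trans nt.
Qed.

Lemma cat_segment m n p t : (m <= n <= p)%N ->
  segment m n t ++ segment n p t = segment m p t.
Proof.
move=> /andP[mn np]; rewrite /segment -map_cat; congr map.
rewrite /index_iota (_ : p - m = (n - m) + (p - n))%N ?iotaD ?subnKC//.
by rewrite addnC addnBA// subnK.
Qed.

Lemma segment_neq0 m n t : (m < n)%N -> segment m n t != [::].
Proof. by move=> mn; rewrite -size_eq0 size_map size_iota subn_eq0 -ltnNge. Qed.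

Lemma big_segment (V : nmodType) (F : seq bool -> V) (G : nat -> V) m n t :
  (n <= (size t).+1)%N ->
  (forall k, (m <= k < n)%N -> F (take k t) = G k) ->
  \sum_(v <- segment m n t) F v = \sum_(m <= k < n) G k.
Proof.
move=> nt FG; rewrite big_map big_seq [RHS]big_seq; apply: eq_bigr => k.
by rewrite mem_index_iota => /FG.
Qed.

Definition extend n t := t ++ nseq (n - size t) false.

Lemma size_extend n t : (size t <= n)%N -> size (extend n t) = n.
Proof. by move=> tn; rewrite size_cat size_nseq subnKC. Qed.

(** Distinct vertices of level [m] have disjoint subtrees: cutting any vertex of the segment back to
    length [m] recovers [t]. *)
Lemma uniq_segment_extend m n (L : seq (seq bool)) : (m <= n)%N ->
  uniq L -> {in L, forall t, size t = m} ->
  uniq (flatten [seq segment m n.+1 (extend n t) | t <- L]).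
Proof.
move=> mn; have seg t v : size t = m -> v \in segment m n.+1 (extend n t) ->
    take m v = t.
  move=> tm; have nt : (n.+1 <= (size (extend n t)).+1)%N.
    by rewrite size_extend ?tm.
  move=> /(mem_segment nt)[/andP[mv _] ->].
  by rewrite take_takel// /extend take_cat tm ltnn subnn take0 cats0.
elim: L => //= t L IH /andP[tL uL] sL.
rewrite cat_uniq uniq_segment ?size_extend ?sL ?mem_head//=.
rewrite IH//; last by move=> u uL'; rewrite sL// inE uL' orbT.
rewrite andbT; apply/hasPn => v /flatten_mapP[u uL' vu].
apply: contraNN tL => vt.
by rewrite -(seg t v (sL t (mem_head _ _)) vt) (seg u)// sL// inE uL' orbT.
Qed.

End tree_paths.

(** * Weighted normal families and the boundedness event *)

Section weighted_normals.
Context d (Omega : measurableType d) (R : realType) (P : probability Omega R).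

Lemma indep_normal_weighted (I : choiceType) (xi : I -> {RV P >-> R})
    (a : I -> R) (L : seq I) :
  (forall i, standard_normal (xi i)) -> mutually_independent xi ->
  (forall i, 0 < a i) -> uniq L ->
  indep_normal_given P (fun i w => a i * xi i w) a setT L.
Proof.
move=> xiN xiI a0 uL B mB; rewrite setTI probability_setT mul1e.
pose B' i := (fun x => a i * x) @^-1` B i.
have mB' i : measurable (B' i).
  by apply: measurable_preimageT => //; exact: measurable_funM.
have LE : perm_eq [fset i in L]%fset L.
  by apply: uniq_perm => //= i; rewrite inE.
have -> : cylinder (fun i w => a i * xi i w) L B =
    \bigcap_(i in [set` [fset i in L]%fset]) (xi i @^-1` B' i).
  by rewrite bigcap_fset /cylinder -(perm_big _ LE).
rewrite xiI// (perm_big _ LE)/=; apply: eq_bigr => i _.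
by rewrite -normal_prob_scale//; exact: (xiN i _ (mB' i)).
Qed.

(** With integer bounds the event becomes a countable increasing union, suited to measurability and
    continuity from below. *)
Lemma as_boundedE (X : seq bool -> Omega -> R) :
  [set w | (ereal_sup [set `|X t w|%:E | t in [set: seq bool]] < +oo)%E] =
  \bigcup_(M : nat) [set w | forall t, `|X t w| <= M%:R].
Proof.
apply/seteqP; split => w /=.
- set S := ereal_sup _ => Sfin.
  have XS t : (`|X t w|%:E <= S)%E by apply: ereal_sup_ubound; exists t.
  have S0 : (0 <= S)%E by apply: le_trans (XS [::]); rewrite lee_fin.
  have Sn : S \is a fin_num by rewrite ge0_fin_numE.
  exists (Num.truncn (fine S)).+1 => // t.
  rewrite -lee_fin (le_trans (XS t))// -(fineK Sn) lee_fin ltW//.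
  by rewrite truncnS_gt.
- case=> M _ XM; apply: (@le_lt_trans _ _ (M%:R)%:E); last exact: ltry.
  by apply: ge_ereal_sup => _ [t _ <-]; rewrite lee_fin.
Qed.

Lemma measurable_bounded_by (X : seq bool -> Omega -> R) (M : R) :
  (forall t, measurable_fun setT (X t)) ->
  measurable [set w | forall t, `|X t w| <= M].
Proof.
move=> mX.
have -> : [set w | forall t, `|X t w| <= M] =
    \bigcap_n \big[setI/setT]_(t <- words n) ((fun w => `|X t w|) @^-1` `]-oo, M]).
  apply/seteqP; split => w /=.
  - move=> XM n _; rewrite -bigcap_seq => t _ /=; rewrite in_itv/=; exact: XM.
  - move=> XM t; have := XM (size t) Logic.I; rewrite -bigcap_seq => /(_ t).
    by rewrite /= mem_words eqxx in_itv/=; apply.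
apply: bigcapT_measurable => n; apply: bigsetI_measurable => t _.
by apply: measurable_preimageT => //; exact: measurableT_comp.
Qed.

End weighted_normals.

(** * Elementary real inequalities *)

Section real_bounds.
Context {R : realType}.
Implicit Types (p x z : R).

(** The hypothesis says [(1 - p)^N >= 1 / (1 + x)]. Since [(1 - p)^N (1 + p)^N <= 1], Bernoulli's
    inequality yields [1 + N p <= (1 + p)^N <= 1 + x]. *)
Lemma bernoulli_mul_le p x (N : nat) : 0 <= p <= 1 -> 0 < x ->
  1 - (1 - p) ^+ N <= x / (1 + x) -> N%:R * p <= x.
Proof.
move=> /andP[p0 p1] x0 h.
have x10 : 0 < 1 + x by lra.
have : (1 + x)^-1 <= (1 - p) ^+ N.
  have -> : (1 + x)^-1 = 1 - x / (1 + x) by field; rewrite gt_eqF.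
  by lra.
have bern : 1 + N%:R * p <= (1 + p) ^+ N.
  elim: N {h} => [|N IH]; first by rewrite mul0r addr0 expr0.
  rewrite exprS mulrSr; have : 0 <= N%:R * p * p by rewrite !mulr_ge0.
  have : (1 + p) * (1 + N%:R * p) <= (1 + p) * (1 + p) ^+ N.
    by rewrite ler_wpM2l// addr_ge0.
  by lra.
have le1 : (1 - p) ^+ N * (1 + p) ^+ N <= 1.
  by rewrite -exprMn exprn_ile1//; nra.
rewrite -(ler_pM2r (exprn_gt0 N (ltr_wpDr p0 ltr01))) => h2.
have := le_trans h2 le1; rewrite mulrC ler_pdivrMr// mul1r; lra.
Qed.

(** Bounding [2^m] below by [exp (m / 2)] gives [m + 4 <= (z + 1)^2]. The 4, which comes from
    [expR (- 2)], forces [z >= 1], and then [(z + 1)^2 <= (2 z)^2]. *)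
Lemma sqrt_le_of_expR_le (m : nat) z : 0 <= z ->
  2 ^+ m * expR (- ((z + 1) ^+ 2 / 2)) <= expR (- 2) -> Num.sqrt m%:R <= 2 * z.
Proof.
move=> z0 h.
have e2 : expR (2^-1) <= 2 :> R.
  have := expR_ge1Dx (- 2^-1 : R); rewrite expRN => h1.
  rewrite -[leLHS]invrK -[leRHS]invrK lef_pV2 ?posrE ?invr_gt0 ?expR_gt0//.
  by lra.
have em : expR (m%:R / 2) <= 2 ^+ m :> R.
  by rewrite expRM_natl lerXn2r ?nnegrE// ltW// expR_gt0.
have : expR (m%:R / 2 + - ((z + 1) ^+ 2 / 2)) <= expR (- 2).
  by rewrite expRD (le_trans _ h)// ler_wpM2r// expR_ge0.
rewrite ler_expR => h3.
have m0 : 0 <= m%:R :> R by [].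
have z1 : 1 <= z by nra.
have -> : 2 * z = Num.sqrt ((2 * z) ^+ 2) by rewrite sqrtr_sqr ger0_norm//; lra.
by rewrite ler_wsqrtr//; nra.
Qed.

Lemma geometric_sum p (N : nat) : \sum_(j < N) p * (1 - p) ^+ j = 1 - (1 - p) ^+ N.
Proof.
elim: N => [|N IH]; first by rewrite big_ord0 expr0 subrr.
by rewrite big_ord_recr/= IH exprS; ring.
Qed.

End real_bounds.

Lemma measure_bigsetU_seq_le d (T : measurableType d) (R : realType)
    (mu : {measure set T -> \bar R}) (I : eqType) (r : seq I)
    (A : I -> set T) (c : R) :
  (forall i, measurable (A i)) -> {in r, forall i, (mu (A i) <= c%:E)%E} ->
  (mu (\big[setU/set0]_(i <- r) A i) <= (c *+ size r)%:E)%E.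
Proof.
move=> mA; elim: r => [_|i r IH mur]; first by rewrite big_nil measure0.
rewrite big_cons mulrS EFinD (le_trans (measureU2 _ _ _))//.
  exact: bigsetU_measurable.
apply: leeD; first by rewrite mur ?mem_head.
by apply: IH => j jr; rewrite mur// inE jr orbT.
Qed.

(** * Laws of branch sums and of the process *)

Section tree_process_law.
Context d (Omega : measurableType d) (R : realType) (P : probability Omega R).
Context (xi : binary_tree -> {RV P >-> R}) (alpha sigma : nat -> R).
Hypothesis xi_normal : forall v, standard_normal (xi v).
Hypothesis xi_indep : mutually_independent xi.
Hypothesis alpha_gt0 : forall k, 0 < alpha k.
Hypothesis sigma_gt0 : forall k, 0 < sigma k.

Local Notation X := (tree_process alpha sigma xi).

Let Z (v : seq bool) (w : Omega) : R := alpha (size v) * xi v w.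
Let s (v : seq bool) : R := alpha (size v).

Let mZ v : measurable_fun setT (Z v).
Proof. exact: measurable_funM. Qed.

Let s_gt0 v : 0 < s v. Proof. exact: alpha_gt0. Qed.

Let indep_Z (L : seq (seq bool)) : uniq L -> indep_normal_given P Z s setT L.
Proof. exact: indep_normal_weighted. Qed.

(** The standard deviation of the part of a branch sum carried by the levels [m] to [n]. *)
Let D m n : R := Num.sqrt (\sum_(m <= k < n.+1) alpha k ^+ 2).

Let D_gt0 m n : (m <= n)%N -> 0 < D m n.
Proof.
move=> mn; rewrite sqrtr_gt0 big_ltn// ltr_pwDl ?exprn_gt0//.
by apply: sumr_ge0 => i _; rewrite sqr_ge0.
Qed.

Let sd_segment m n t : (n <= size t)%N ->
  sd_over s (segment m n.+1 t) = D m n.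
Proof.
move=> nt; congr Num.sqrt; apply: big_segment => // k /andP[_ kn].
by rewrite /s size_takel// (leq_trans _ nt).
Qed.

Lemma tree_processE t w :
  X t w = sigma (size t) * sum_over Z (segment 0 (size t).+1 t) w.
Proof.
rewrite /tree_process levelE; congr (_ * _).
rewrite branch_sumE /sum_over /segment big_map big_mkord.
by apply: eq_bigr => k _; rewrite levelE.
Qed.

Lemma measurable_tree_process t : measurable_fun setT (X t).
Proof.
have -> : X t = fun w =>
    sigma (size t) * sum_over Z (segment 0 (size t).+1 t) w.
  by apply/funext => w; exact: tree_processE.
apply: measurable_funM => //; exact: measurable_sum_over.
Qed.

Let measurable_exceed (u : R) t : measurable [set w | u < `|X t w|].
Proof.
have -> : [set w | u < `|X t w|] = (fun w => `|X t w|) @^-1` `]u, +oo[.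
  by apply/seteqP; split => x /=; rewrite in_itv/= andbT.
apply: measurable_preimageT => //; apply: measurableT_comp => //.
exact: measurable_tree_process.
Qed.

Let level_tail n t (u : R) : size t = n -> 0 <= u ->
  (P [set w | (u < `|X t w|)%R] <=
   (Num.sqrt 2 * expR (- ((u / sigma n) ^+ 2 / (D 0 n ^+ 2 * 4))))%:E)%E.
Proof.
move=> tn u0.
have u0' : 0 <= u / sigma n by rewrite divr_ge0// ltW.
apply: le_trans (normal_prob_norm_gt_le (D_gt0 (leq0n n)) u0').
pose C := [set x : R | u / sigma n < `|x|]; rewrite -/C.
have mC : measurable C.
  have -> : C = (fun x : R => `|x|) @^-1` `]u / sigma n, +oo[.
    by apply/seteqP; split => x /=; rewrite in_itv/= andbT.
  by apply: measurable_preimageT => //; exact: measurableT_comp.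
have snt : (n <= size t)%N by rewrite tn.
have useg : uniq (segment 0 n.+1 t) by rewrite uniq_segment// tn.
have := sum_over_normal_given mZ s_gt0 useg (segment_neq0 _ (ltn0Sn n))
  measurableT (indep_Z useg) mC.
rewrite setTI probability_setT mul1e sd_segment// => <-.
rewrite le_measure ?inE//.
- by apply: measurable_preimageT => //; exact: measurable_sum_over.
move=> w /=; rewrite /C/= tree_processE tn normrM gtr0_norm//.
by rewrite ltr_pdivrMr// mulrC.
Qed.

(** * Boundedness from finiteness of [G2] *)

Lemma bounded_of_G2 : (G2 alpha sigma < +oo)%E -> as_bounded P X.
Proof.
set S := G2 _ _ => Sfin.
have S0 : (0 <= S)%E.
  apply: ereal_sup_ubound; exists 0%N => //.
  by rewrite sqrtr0 mulr0 mul0r.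
have Sn : S \is a fin_num by rewrite ge0_fin_numE.
(* Adding 1 makes the bound positive at once. *)
pose g : R := fine S + 1.
have g0 : 0 < g by rewrite ltr_wpDl// fine_ge0.
have Dg n : sigma n * Num.sqrt n%:R * D 0 n <= g.
  apply: (@le_trans _ _ (fine S)); last by rewrite lerDl.
  by rewrite -lee_fin fineK//; apply: ereal_sup_ubound; exists n.
rewrite /as_bounded as_boundedE; set A := \bigcup_M _.
have mA : measurable A.
  apply: bigcupT_measurable => M; apply: measurable_bounded_by => t.
  exact: measurable_tree_process.
suff small (e : R) : 0 < e -> e <= 1 -> (P (~` A) <= e%:E)%E.
  have : P (~` A) = 0%E.
    apply/eqP; rewrite -measure_le0; apply/lee_addgt0Pr => e e0.
    rewrite add0e; have [e1|e1] := leP e 1; first exact: small.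
    by rewrite (le_trans (small 1 _ _))// lee_fin ltW.
  rewrite probability_setC// => /eqP; rewrite sube_eq ?fin_num_measure//.
    by rewrite add0e => /eqP.
move=> e0 e1.
(* By [Dg], this [C] makes the tail at a vertex of level [n + 1] at most [2 q^(n + 1)]. Over the
   [2^(n + 1)] vertices this sums to [2 (e / 4)^(n + 1)], which is at most [e / 2^(n + 1)] as
   [e <= 1]. *)
pose q := e / 8; pose C := 2 * g * Num.sqrt (- ln q).
have q0 : 0 < q by rewrite divr_gt0.
have lnq : 0 <= - ln q by rewrite oppr_ge0 ln_le0// /q; lra.
have C0 : 0 <= C by rewrite mulr_ge0 ?sqrtr_ge0// mulr_ge0// ltW.
(* The levels start at 1, since [Dg] says nothing at level 0. The root enters only through the
   random bound [M] below. *)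
pose U n := \big[setU/set0]_(t <- words n.+1) [set w | C < `|X t w|].
have mU n : measurable (U n).
  by apply: bigsetU_measurable => t _; exact: measurable_exceed.
have AU : ~` A `<=` \bigcup_n U n.
  apply: subsetCl => w nU.
  pose M := Num.max C `|X [::] w|.
  exists (Num.truncn M).+1 => // t /=.
  apply: (@le_trans _ _ M); last by rewrite ltW// truncnS_gt.
  rewrite /M le_max; case: t => [|b t]; first by rewrite lexx orbT.
  rewrite leNgt; apply/orP; left; apply/negP => CX; apply: nU.
  exists (size t) => //; rewrite /U -bigcup_seq; exists (b :: t) => //=.
  by rewrite mem_words.
have PU n : (P (U n) <= (e / (2 ^ n.+1)%:R)%:E)%E.
  apply: (@le_trans _ _ ((2 * q ^+ n.+1) *+ size (words n.+1))%:E).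
    apply: measure_bigsetU_seq_le => // t; rewrite mem_words => /eqP tn.
    apply: le_trans (level_tail tn C0) _; rewrite lee_fin.
    apply: ler_pM; rewrite ?sqrtr_ge0 ?expR_ge0//.
      by rewrite -[leRHS]gtr0_norm// -sqrtr_sqr ler_sqrt// ; lra.
    rewrite -[q in leRHS]lnK// -expRM_natl ler_expR lerNl -mulrN.
    have D0 : 0 < D 0 n.+1 by exact: D_gt0.
    rewrite /C !exprMn exprVn sqr_sqrtr//.
    have : (sigma n.+1 * Num.sqrt n.+1%:R * D 0 n.+1) ^+ 2 <= g ^+ 2.
      by rewrite lerXn2r ?nnegrE ?mulr_ge0 ?sqrtr_ge0 ?(ltW (sigma_gt0 _)) ?(ltW g0).
    rewrite !exprMn sqr_sqrtr// => sg.
    have sD : 0 < sigma n.+1 ^+ 2 * D 0 n.+1 ^+ 2 by rewrite mulr_gt0 ?exprn_gt0.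
    have -> : 2 ^+ 2 * g ^+ 2 * - ln q / sigma n.+1 ^+ 2 / (D 0 n.+1 ^+ 2 * 4) =
        g ^+ 2 * - ln q / (sigma n.+1 ^+ 2 * D 0 n.+1 ^+ 2).
      by field; rewrite !gt_eqF.
    by rewrite ler_pdivlMr// mulrAC ler_wpM2r// mulrCA mulrA.
  rewrite size_words lee_fin -mulr_natl natrX ler_pdivlMr ?exprn_gt0//.
  have -> : 2 ^+ n.+1 * (2 * q ^+ n.+1) * 2 ^+ n.+1 = e * (e / 2) ^+ n.
    rewrite mulrAC mulrCA -!exprMn.
    have -> : 2 * 2 * q = e / 2 by rewrite /q; field.
    by rewrite exprS; field.
  by rewrite ler_piMr ?(ltW e0)// exprn_ile1//; lra.
apply: (@le_trans _ _ (P (\bigcup_n U n))).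
  rewrite le_measure ?inE//; first exact: measurableC.
  exact: bigcupT_measurable.
apply: (@le_trans _ _ (\sum_(n <oo) P (U n))%E).
  apply: generalized_Boole_inequality => //; exact: bigcupT_measurable.
apply: (@le_trans _ _ (\sum_(n <oo) (e / (2 ^ n.+1)%:R)%:E)%E).
  exact: lee_nneseries.
by apply: (epsilon_trick0 xpredT); exact: ltW.
Qed.

(** * Finiteness of [G1] from boundedness *)

Let in_cylinder (K : choiceType) (Y : K -> Omega -> R) (r : seq K) B w :
  cylinder Y r B w -> forall k, k \in r -> B k (Y k w).
Proof. by rewrite /cylinder -bigcap_seq => + k kr; apply. Qed.

(* For a level-[m] vertex [t] followed downwards to level [n], [None] stands
   for the part of the branch above level [m] and [Some t'] for the part of the
   branch of [t'] between the levels [m] and [n]. *)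
Let block m n t (k : option (seq bool)) : seq (seq bool) :=
  if k is Some t' then segment m n.+1 (extend n t') else segment 0 m (extend n t).

Let target (u : R) t (k : option (seq bool)) : set R :=
  if k is Some t' then (if t' == t then `]u, +oo[%classic else `]-oo, u]%classic)
  else `[0, +oo[%classic.

(* [t] is the first vertex of the list [rcons L t] at which the lower block
   exceeds [u], and its upper block is nonnegative. *)
Let first_exceed m n u L t : set Omega :=
  cylinder (fun k => sum_over Z (block m n t k))
    (None :: map Some (t :: L)) (target u t).

Let le_size_extend n t : (n <= size (extend n t))%N.
Proof. by rewrite size_cat size_nseq -leq_subLR. Qed.

Let block_neq0 m n t k : (0 < m)%N -> (m <= n)%N -> block m n t k != [::].
Proof. by move=> m0 mn; case: k => [t'|]; apply: segment_neq0. Qed.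

Let measurable_target u t k : measurable (target u t k).
Proof. by rewrite /target; case: k => [t'|]//; case: ifP. Qed.

Let measurable_first_exceed m n u L t : measurable (first_exceed m n u L t).
Proof.
apply: measurable_cylinder => [k|k]; last exact: measurable_target.
exact: measurable_sum_over.
Qed.

(** The upper block lives on levels below [m], the lower ones on levels from [m] on; the latter are
    disjoint by [uniq_segment_extend]. *)
Let uniq_blocks m n L t : (0 < m)%N -> (m <= n)%N -> uniq (t :: L) ->
  {in t :: L, forall v, size v = m} ->
  uniq (flatten [seq block m n t k | k <- None :: map Some (t :: L)]).
Proof.
move=> m0 mn utL stL; rewrite [map _ (None :: _)]/= [flatten _]/= cat_uniq.
have mt : (m <= (size (extend n t)).+1)%N.
  by rewrite (leq_trans mn)// ltnW// ltnS le_size_extend.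
rewrite uniq_segment//=.
have := uniq_segment_extend mn utL stL.
have -> : block m n t (Some t) ++
    flatten [seq block m n t k | k <- [seq Some i | i <- L]] =
    flatten [seq segment m n.+1 (extend n t') | t' <- t :: L].
  by rewrite -map_comp.
move=> ->; rewrite andbT; apply/hasPn => v /flatten_mapP[u _].
move=> /mem_segment[|/andP[mv _] _]; first by rewrite ltnS le_size_extend.
by apply/negP => /(mem_segment mt)[]; rewrite (leq_gtF mv) andbF.
Qed.

Let tail_prob m n u : R := fine (normal_prob 0 (D m n) `]u, +oo[).

(** The blocks are disjoint, so the probability factors: at least 1/2 for the upper block by
    symmetry, [p] for the lower block of [t], and [1 - p] for each vertex of [L]. *)
Let prob_first_exceed m n u L t : (0 < m)%N -> (m <= n)%N -> 0 <= u ->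
  uniq (t :: L) -> {in t :: L, forall v, size v = m} ->
  ((2^-1 * (tail_prob m n u * (1 - tail_prob m n u) ^+ size L))%:E <=
   P (first_exceed m n u L t))%E.
Proof.
move=> m0 mn u0 utL stL; set p := tail_prob m n u.
have := sums_over_normal_given mZ s_gt0 (fun k => block_neq0 t k m0 mn)
  (uniq_blocks m0 mn utL stL) measurableT (indep_Z (uniq_blocks m0 mn utL stL))
  (measurable_target u t).
rewrite setTI probability_setT mul1e -/(first_exceed m n u L t) => ->.
rewrite !big_cons big_map.
have sdE t' : sd_over s (block m n t (Some t')) = D m n.
  by rewrite sd_segment// le_size_extend.
have pE : normal_prob 0 (D m n) `]u, +oo[ = p%:E.
  by rewrite fineK// fin_num_measure.
have qE : normal_prob 0 (D m n) `]-oo, u] = (1 - p)%:E.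
  have qE : normal_prob 0 (D m n) (~` `]u, +oo[) =
      (1 - normal_prob 0%R (D m n) `]u, +oo[)%E.
    exact: (probability_setC (normal_prob 0 (D m n)) (measurable_itv _)).
  by rewrite -setCitvr qE pE EFinB.
rewrite sdE [target u t (Some t)]/target eqxx pE.
rewrite (eq_big_seq (fun=> (1 - p)%:E)); last first.
  move=> v vL; rewrite sdE /target ifF//.
  by apply/negbTE; apply: contraTneq vL => ->; case/andP: utL.
rewrite prodEFin big_const_seq count_predT iter_mulr_1.
have p01 : 0 <= p <= 1.
  rewrite -!lee_fin -pE measure_ge0/=; exact: probability_le1.
rewrite EFinM -(EFinM p) lee_wpmul2r//.
  by rewrite lee_fin mulr_ge0 ?exprn_ge0//; lra.
by apply: normal_prob_ge0_ge_half; apply: sd_over_gt0 => //; exact: segment_neq0.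
Qed.

(** The events contradict each other at the lower block of [t]: the first puts its sum above [u],
    the second at most [u]. *)
Let first_exceed_disjoint m n u L t L' t' : t \in L' -> t' \notin t :: L ->
  first_exceed m n u L t `&` first_exceed m n u L' t' = set0.
Proof.
move=> tL'; rewrite inE negb_or => /andP[tt' _].
apply/seteqP; split => // w [].
move=> /in_cylinder/(_ (Some t)); rewrite !inE eqxx orbT => /(_ isT).
rewrite /target eqxx /= in_itv/= andbT => ut.
move=> /in_cylinder/(_ (Some t)); rewrite !inE (mem_map Some_inj) tL' !orbT.
move=> /(_ isT); rewrite /target eq_sym (negbTE tt') /= in_itv/= leNgt.
by rewrite ut.
Qed.

Let first_exceed_unbounded m n M L t : (m <= n)%N -> size t = m -> 0 <= M ->
  first_exceed m n (M / sigma n) L t `<=` ~` [set w | forall t, `|X t w| <= M].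
Proof.
move=> mn tm M0 w Fw; apply/existsNP; exists (extend n t); apply/negP.
have := in_cylinder Fw (mem_head None _); rewrite /target/= in_itv/= andbT => A0.
have := in_cylinder Fw (k := Some t).
rewrite !inE eqxx orbT => /(_ isT); rewrite /target eqxx /= in_itv/= andbT => B0.
have Xn : X (extend n t) w = sigma n *
    (sum_over Z (block m n t None) w + sum_over Z (block m n t (Some t)) w).
  rewrite tree_processE size_extend ?tm// /sum_over -big_cat/=.
  by rewrite cat_segment// leq0n leqW.
rewrite -ltNge (lt_le_trans _ (ler_norm _))// Xn.
move: B0; rewrite ltr_pdivrMr// => B0.
rewrite mulrDr (lt_le_trans B0)// mulrC lerDr mulr_ge0//.
exact: ltW.
Qed.

Let peak : R := (Num.sqrt (pi *+ 2))^-1.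

(** Chosen so that [2^m p <= threshold], combined with [normal_prob_gt_ge], becomes the hypothesis
    of [sqrt_le_of_expR_le] once [peak] cancels. *)
Let threshold : R := peak * expR (- 2).

Let level_lower_bound M m n : (0 < m)%N -> (m <= n)%N -> 0 <= M ->
  (P (~` [set w | (forall t, `|X t w| <= M)%R]) <=
   (2^-1 * (threshold / (1 + threshold)))%:E)%E ->
  sigma n * Num.sqrt m%:R * D m n <= 2 * M.
Proof.
move=> m0 mn M0; set bd := [set w | _]; set x := threshold => Pbd.
have peak0 : 0 < peak by rewrite invr_gt0 sqrtr_gt0 mulrn_wgt0// pi_gt0.
have x0 : 0 < x by rewrite mulr_gt0 ?expR_gt0.
have Dmn : 0 < D m n by exact: D_gt0.
pose u := M / sigma n; have u0 : 0 <= u by rewrite divr_ge0// ltW.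
pose p := tail_prob m n u.
have pE : normal_prob 0 (D m n) `]u, +oo[ = p%:E.
  by rewrite fineK// fin_num_measure.
have p01 : 0 <= p <= 1.
  rewrite -!lee_fin -pE measure_ge0/=; exact: probability_le1.
pose ts := words m; pose tn j := nth [::] ts j.
(* Level [m] is scanned in the order of [ts]; the predecessors of the [j]-th vertex are
   [take j ts]. *)
pose F (j : 'I_(size ts)) := first_exceed m n u (take j ts) (tn j).
have tn_ts (j : 'I_(size ts)) : tn j \in ts by exact: mem_nth.
have utn (j : 'I_(size ts)) : uniq (tn j :: take j ts).
  have : uniq (take j.+1 ts) by rewrite take_uniq// uniq_words.
  by rewrite (take_nth [::])// rcons_uniq.
have stn (j : 'I_(size ts)) : {in tn j :: take j ts, forall v, size v = m}.
  move=> v vj; apply/eqP; rewrite -mem_words.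
  by move: vj; rewrite inE => /orP[/eqP ->|/mem_take].
have mF j : measurable (F j) by exact: measurable_first_exceed.
have FF (i j : 'I_(size ts)) : (i < j)%N -> F i `&` F j = set0.
  move=> ij; apply: first_exceed_disjoint.
    by rewrite /tn -(nth_take [::] ij) mem_nth// size_take_min leq_min ij/=.
  rewrite inE negb_or /tn nth_uniq ?uniq_words// gt_eqF//=.
  apply/negP => /(nthP [::])[k]; rewrite size_takel; last exact: ltnW.
  move=> ki; rewrite nth_take// => /eqP; rewrite nth_uniq ?uniq_words//.
    by rewrite ltn_eqF// (ltn_trans ki).
  by rewrite (ltn_trans ki).
have tF : trivIset setT F.
  apply/trivIsetP => i j _ _ ij.
  have [h|h] := ltnP i j; first exact: FF.
  by rewrite setIC FF// ltn_neqAle eq_sym h andbT.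
have UF : \big[setU/set0]_(j < size ts) F j `<=` ~` bd.
  rewrite -bigcup_seq => w [j _ Fw].
  by apply: (first_exceed_unbounded mn _ M0 Fw); apply: (stn j); rewrite mem_head.
have mbd : measurable bd.
  by apply: measurable_bounded_by => t; exact: measurable_tree_process.
have mUF : measurable (\big[setU/set0]_(j < size ts) F j).
  exact: bigsetU_measurable.
(* The disjoint events [F j] lie outside [bd], and the lower bounds on their probabilities form a
   geometric sum. *)
have sumP : ((2^-1 * (1 - (1 - p) ^+ (2 ^ m)))%:E <= P (~` bd))%E.
  apply: (@le_trans _ _ (P (\big[setU/set0]_(j < size ts) F j))); last first.
    by rewrite le_measure ?inE//; exact: measurableC.
  rewrite measure_semi_additive_ord// -size_words -/ts -geometric_sum mulr_sumr.
  rewrite -sumEFin; apply: lee_sum => j _.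
  have := prob_first_exceed m0 mn u0 (utn j) (stn j).
  by rewrite /= size_takel// ltnW.
have := le_trans sumP Pbd; rewrite lee_fin ler_pM2l ?invr_gt0// => h.
have Np := bernoulli_mul_le p01 x0 h.
have := normal_prob_gt_ge Dmn u0; rewrite pE lee_fin -/peak => pk.
have z0 : 0 <= u / D m n by rewrite divr_ge0// ltW.
have : 2 ^+ m * expR (- ((u / D m n + 1) ^+ 2 / 2)) <= expR (- 2).
  rewrite -(ler_pM2l peak0) mulrCA (le_trans _ Np)// natrX.
  by rewrite ler_wpM2l// exprn_ge0.
(* Now [sqrt m <= 2 M / (sigma n * D m n)]; only rearranging is left. *)
move=> /(sqrt_le_of_expR_le z0); rewrite /u => hm.
rewrite mulrAC -ler_pdivlMl ?mulr_gt0// (le_trans hm)// le_eqVlt; apply/orP; left.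
by apply/eqP; field; rewrite !gt_eqF.
Qed.

Lemma G1_of_bounded : as_bounded P X -> (G1 alpha sigma < +oo)%E.
Proof.
rewrite /as_bounded as_boundedE => PA.
pose bd (M : nat) := [set w | forall t, `|X t w| <= M%:R].
have mbd M : measurable (bd M).
  by apply: measurable_bounded_by => t; exact: measurable_tree_process.
have mA : measurable (\bigcup_M bd M) by exact: bigcupT_measurable.
pose x := threshold.
have peak0 : 0 < peak by rewrite invr_gt0 sqrtr_gt0 mulrn_wgt0// pi_gt0.
have x0 : 0 < x by rewrite mulr_gt0 ?expR_gt0.
pose c := 2^-1 * (x / (1 + x)).
have c0 : 0 < c by rewrite mulr_gt0 ?invr_gt0// divr_gt0// addr_gt0.
(* Continuity from below: if every [M] failed, the union of the [bd M] would have probability at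
   most [1 - c]. *)
have [M PM] : exists M, (P (~` bd M) <= c%:E)%E.
  apply: contrapT => /forallNP h.
  have ndbd : nondecreasing_seq bd.
    move=> i j ij; apply/subsetPset => w /= wi t.
    by rewrite (le_trans (wi t))// ler_nat.
  have cvgP := nondecreasing_cvg_mu (mu := P) mbd mA ndbd.
  have : (P (\bigcup_M bd M) <= (1 - c)%:E)%E.
    rewrite -(cvg_lim _ cvgP)//; apply: lime_le.
      by apply/cvg_ex; eexists; exact: cvgP.
    apply: nearW => M /=; have := h M; rewrite probability_setC//.
    rewrite -(fineK (fin_num_measure P _ (mbd M))) -EFinB !lee_fin.
    by move/negP; rewrite -ltNge; lra.
  by rewrite PA lee_fin; lra.
apply: (@le_lt_trans _ _ (2 * M%:R)%:E); last exact: ltry.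
apply: ge_ereal_sup => _ [n _ <-]; apply: ge_ereal_sup => _ [m /= mn <-].
(* For [m = 0] the factor [sqrt m] makes the term vanish; [level_lower_bound] needs a nonempty upper
   block. *)
rewrite lee_fin; have [->|m0] := posnP m.
  by rewrite sqrtr0 mulr0 mul0r mulr_ge0.
exact: level_lower_bound.
Qed.

End tree_process_law.

(** * Comparison of [G1] and [G2] *)

Section G1_G2.
Context {R : realType}.
Implicit Types alpha sigma : nat -> R.

Lemma G1_le_G2 alpha sigma : (forall k, 0 < sigma k) ->
  (G1 alpha sigma <= G2 alpha sigma)%E.
Proof.
move=> sigma0; apply: ge_ereal_sup => _ [n _ <-].
apply: ge_ereal_sup => _ [m /= mn <-].
apply: (@le_trans _ _ (sigma n * Num.sqrt n%:R *
    Num.sqrt (\sum_(0 <= k < n.+1) alpha k ^+ 2))%:E); last first.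
  by apply: ereal_sup_ubound; exists n.
have s0 := ltW (sigma0 n).
rewrite lee_fin ler_pM ?mulr_ge0 ?sqrtr_ge0//.
  by rewrite ler_wpM2l// ler_wsqrtr// ler_nat.
rewrite ler_wsqrtr// (big_cat_nat (leq0n m) (leqW mn))/= lerDr.
by apply: sumr_ge0 => k _; rewrite sqr_ge0.
Qed.

(** The value [alpha m ^+ 2] at the midpoint [m] separates the two halves, and the upper half has at
    least as many terms. *)
Lemma sum_sqr_le_upper_half alpha n :
  (forall k, 0 < alpha k) -> nondecreasing_seq alpha ->
  \sum_(0 <= k < n.+1) alpha k ^+ 2 <=
  2 * \sum_(n.+1./2 <= k < n.+1) alpha k ^+ 2.
Proof.
move=> alpha0 nd; set m := n.+1./2.
have m2 : (m + m <= n.+1)%N.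
  by rewrite addnn -[leqRHS](odd_double_half n.+1) leq_addl.
have mn : (m <= n.+1)%N by rewrite (leq_trans _ m2)// leq_addr.
have mono i j : (i <= j)%N -> alpha i ^+ 2 <= alpha j ^+ 2.
  by move=> ij; rewrite lerXn2r ?nnegrE ?(ltW (alpha0 _))//; exact: nd.
rewrite (big_cat_nat (leq0n m) mn)/= mulr_natl mulr2n lerD2r.
apply: (@le_trans _ _ (\sum_(0 <= k < m) alpha m ^+ 2)).
  by rewrite ler_sum_nat// => k /andP[_ /ltnW]; exact: mono.
apply: (@le_trans _ _ (\sum_(m <= k < n.+1) alpha m ^+ 2)); last first.
  by rewrite ler_sum_nat// => k /andP[mk _]; exact: mono.
by rewrite !sumr_const_nat subn0 ler_wpMn2l ?sqr_ge0// leq_subRL// addnC.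
Qed.

(** The [n]-th term of [G2] is compared with the term of [G1] at [m = n.+1./2], which is [n / 2]
    rounded up. Both [n <= 2 m] and [sum_sqr_le_upper_half] cost a factor [sqrt 2], whence the bound
    by twice [G1]. *)
Lemma G2_fin_of_G1_fin alpha sigma :
  (forall k, 0 < alpha k) -> (forall k, 0 < sigma k) -> nondecreasing_seq alpha ->
  (G1 alpha sigma < +oo)%E -> (G2 alpha sigma < +oo)%E.
Proof.
move=> alpha0 sigma0 nd Sfin.
have S_ub m n : (m <= n)%N -> ((sigma n * Num.sqrt m%:R *
    Num.sqrt (\sum_(m <= k < n.+1) alpha k ^+ 2))%:E <= G1 alpha sigma)%E.
  move=> mn; apply: le_trans; last by apply: ereal_sup_ubound; exists n.
  by apply: ereal_sup_ubound; exists m.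
set S := G1 _ _ in Sfin S_ub.
have S0 : (0 <= S)%E.
  by apply: le_trans (S_ub 0%N 0%N _); rewrite // sqrtr0 mulr0 mul0r.
have Sn : S \is a fin_num by rewrite ge0_fin_numE.
apply: (@le_lt_trans _ _ (2 * fine S)%:E); last exact: ltry.
apply: ge_ereal_sup => _ [n _ <-]; rewrite lee_fin.
set m := n.+1./2.
have nm : (n <= 2 * m)%N.
  rewrite -ltnS -[ltnRHS]add1n mul2n -[leqLHS](odd_double_half n.+1).
  by rewrite leq_add2r; case: odd.
have mn : (m <= n)%N by rewrite leq_half_double ltnS -addnn leq_addr.
apply: (@le_trans _ _ (2 * (sigma n * Num.sqrt m%:R *
    Num.sqrt (\sum_(m <= k < n.+1) alpha k ^+ 2)))); last first.
  by rewrite ler_wpM2l// -lee_fin fineK// S_ub.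
have r2 : Num.sqrt 2 * Num.sqrt 2 = 2 :> R by rewrite -expr2 sqr_sqrtr.
have s0 := ltW (sigma0 n).
rewrite -[X in X * (_ * _)]r2 mulrACA.
rewrite ler_pM ?mulr_ge0 ?sqrtr_ge0//.
  by rewrite mulrCA ler_wpM2l// -sqrtrM// ler_wsqrtr// -natrM ler_nat.
by rewrite -sqrtrM// ler_wsqrtr// sum_sqr_le_upper_half.
Qed.

End G1_G2.

Theorem theorem6p3 (d : measure_display) (Omega : measurableType d)
    (R : realType) (P : probability Omega R)
    (xi : binary_tree -> {RV P >-> R}) (alpha sigma : nat -> R)
    (xi_normal : forall v, standard_normal (xi v))
    (xi_indep : mutually_independent xi)
    (alpha_gt0 : forall k, 0 < alpha k)
    (sigma_gt0 : forall k, 0 < sigma k)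
    (sigma_noninc : nonincreasing_seq sigma) :
  [/\ as_bounded P (tree_process alpha sigma xi) -> (G1 alpha sigma < +oo)%E,
      (G2 alpha sigma < +oo)%E -> as_bounded P (tree_process alpha sigma xi)
    & nondecreasing_seq alpha ->
      [/\ (G1 alpha sigma < +oo)%E <-> (G2 alpha sigma < +oo)%E,
          as_bounded P (tree_process alpha sigma xi) <->
            (G1 alpha sigma < +oo)%E
        & as_bounded P (tree_process alpha sigma xi) <->
            (G2 alpha sigma < +oo)%E]].
Proof.
have a : as_bounded P (tree_process alpha sigma xi) -> (G1 alpha sigma < +oo)%E.
  exact: G1_of_bounded.
have b : (G2 alpha sigma < +oo)%E -> as_bounded P (tree_process alpha sigma xi).
  exact: bounded_of_G2.
split=> // nd.
have c : (G1 alpha sigma < +oo)%E -> (G2 alpha sigma < +oo)%E.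
  exact: G2_fin_of_G1_fin.
have c' : (G2 alpha sigma < +oo)%E -> (G1 alpha sigma < +oo)%E.
  by apply: le_lt_trans; exact: G1_le_G2.
by split; split; auto.
Qed.
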